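(* Let $\mathcal{G}$ be a simple undirected graph and let $\mathcal{T}$ be any dissecting tree set for $\mathcal{G}$. Regard $\mathcal{G}$ as a bidirected graph (each edge $uv$ replaced by the two directed edges $\overrightarrow{uv}$ and $\overrightarrow{vu}$), and fix any total ordering of these directed edges. Then for every $i$, the coefficient of $x^i$ in the $h^*$-polynomial of the symmetric edge polytope $P_{\mathcal{G}}$ equals $$|\{T\in \mathcal{T}\mid T \text{ has exactly } i \text{ internally semi-passive edges}\}|,$$ where internal semi-passivity is taken with respect to the fixed ordering in the bidirected graph.
   Context: For a vertex $u$, $\mathbf{1}_u$ denotes the standard basis vector of $\mathbb{R}^{V(\mathcal{G})}$. The symmetric edge polytope is $P_{\mathcal{G}}=\mathrm{conv}\{\mathbf{1}_u-\mathbf{1}_w,\ \mathbf{1}_w-\mathbf{1}_u \mid uw\in E(\mathcal{G})\}$. For a directed graph $D$, $\mathcal{Q}_D=\mathrm{conv}\{\mathbf{1}_h-\mathbf{1}_t \mid \overrightarrow{th}\in E(D)\}$. An oriented spanning tree of $\mathcal{G}$ is a spanning tree in which each edge is given one of its two orientations (so it is a spanning tree of the bidirected graph). A dissecting tree set for $\mathcal{G}$ is a set $\mathcal{T}$ of oriented spanning trees of $\mathcal{G}$ such that the simplices $\mathcal{Q}_T$, $T\in\mathcal{T}$, have pairwise disjoint relative interiors and their union is the boundary of $P_{\mathcal{G}}$. For a digraph $G$, a spanning tree $T$ and $e\in T$, the fundamental cut $C^*(T,e)$ is the set of edges of $G$ joining the two components (shores) of $T-e$; an edge $e'\in C^*(T,e)$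 stands parallel to $e$ if the heads of $e$ and $e'$ lie in the same shore, and stands opposite to $e$ otherwise. Given a total order on $E(G)$, an edge $e\in T$ is internally semi-passive for $T$ if the maximal edge of $C^*(T,e)$ stands opposite to $e$ (otherwise it is internally semi-active). For a $d$-dimensional lattice polytope $P\subset\mathbb{R}^n$ with Ehrhart polynomial $\varepsilon_P(t)=|tP\cap\mathbb{Z}^n|$, writing uniquely $\varepsilon_P(t)=\sum_{k=0}^d a_k\binom{t+d-k}{d}$, the $h^*$-polynomial of $P$ is $\sum_{k=0}^d a_k x^k$. *)

(* Defs.v *)
From HB Require Import structures.
From mathcomp Require Export all_boot all_order all_algebra.
From mathcomp Require Export finmap.
From mathcomp Require Export boolp classical_sets functions cardinality.
From mathcomp Require Export reals topology.

Set Implicit Arguments.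
Unset Strict Implicit.
Unset Printing Implicit Defensive.

Import Order.TTheory GRing.Theory Num.Theory.
Import numFieldTopology.Exports.

Local Open Scope classical_set_scope.
Local Open Scope ring_scope.

Section Polytopes.
Variables (R : realType) (n : nat).
Implicit Types (S P : set 'rV[R]_n) (h : {poly R}).

Definition conv_hull S : set 'rV[R]_n :=
  [set x | exists k (p : 'I_k -> 'rV[R]_n) (c : 'I_k -> R),
    [/\ forall i, S (p i), forall i, 0 <= c i, \sum_i c i = 1
      & x = \sum_i c i *: p i]].

Definition affine_hull S : set 'rV[R]_n :=
  [set x | exists k (p : 'I_k -> 'rV[R]_n) (c : 'I_k -> R),
    [/\ forall i, S (p i), \sum_i c i = 1 & x = \sum_i c i *: p i]].

Definition relative_interior S : set 'rV[R]_n :=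
  [set x | S x /\ \forall y \near x, affine_hull S y -> S y].

Definition relative_boundary S : set 'rV[R]_n :=
  closure S `\` relative_interior S.

(* The empty set has no dimension. *)
Definition has_dim S (d : nat) : Prop :=
  exists (x : 'rV[R]_n) (U : {vspace 'rV[R]_n}),
    \dim U = d /\ affine_hull S = [set x + u | u in [set u | u \in U]].

Definition lattice : set 'rV[R]_n :=
  [set x | forall j, x ord0 j \is a Num.int].

Definition dilate (t : nat) P : set 'rV[R]_n := [set t%:R *: x | x in P].

(* [fset_set] is junk on infinite sets; this is used for bounded [P] only. *)
Definition ehrhart P (t : nat) : nat :=
  #|` fset_set (dilate t P `&` lattice)|%fset.

(* For natural t and k <= d the truncated subtraction t + d - k is exact. *)
Definition is_hstar_poly P h : Prop :=
  exists d : nat,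
    [/\ has_dim P d, (size h <= d.+1)%N
      & forall t : nat,
          (ehrhart P t)%:R = \sum_(k < d.+1) h`_k * 'C(t + d - k, d)%:R].

(* Well defined by [is_hstar_poly_unique] below. *)
Definition hstar_poly P : {poly R} := xget 0 (is_hstar_poly P).

End Polytopes.

Section Graphs.
Variable V : finType.
Local Open Scope set_scope.

(* An arc (t, h) : V * V is the directed edge from its tail t to its head h;
   a digraph on V is its set of arcs. *)
Implicit Types (D T : {set V * V}) (a f g : V * V) (le : rel (V * V)).

Definition simple_graph (e : rel V) : Prop := symmetric e /\ irreflexive e.

Definition bidirected (e : rel V) : {set V * V} := [set a | e a.1 a.2].

Definition adj T : rel V := [rel u v | ((u, v) \in T) || ((v, u) \in T)].

(* [adj T] forgets multiplicities, so 2-cycles are excluded by the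
   antiparallel-arc condition, and loops by c = [:: u]. *)
Definition spanning_tree D T : Prop :=
  [/\ T \subset D,
      forall u v, connect (adj T) u v,
      forall u v, (u, v) \in T -> (v, u) \notin T
    & forall c : seq V, ucycle (adj T) c -> (size c == 0)%N || (size c == 2)%N].

Definition same_shore T a : rel V := connect (adj (T :\ a)).

Definition fundamental_cut D T a : {set V * V} :=
  [set f in D | ~~ same_shore T a f.1 f.2].

Definition stands_parallel T a f : bool := same_shore T a a.2 f.2.

Definition stands_opposite T a f : bool := ~~ stands_parallel T a f.

Definition total_order_on D le : Prop :=
  [/\ {in D, reflexive le}, {in D &, antisymmetric le},
      {in D & &, transitive le} & {in D &, total le}].

Definition is_max_of le (A : {set V * V}) f : bool :=
  (f \in A) && [forall g in A, le g f].

Definition semi_passive D le T a : bool :=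
  (a \in T) &&
  [exists f, is_max_of le (fundamental_cut D T a) f && stands_opposite T a f].

Definition num_semi_passive D le T : nat := #|[set a | semi_passive D le T a]|.

End Graphs.

Section GraphPolytopes.
Variables (R : realType) (V : finType).

(* R^V is represented by 'rV[R]_#|V|, coordinates being indexed through
   [enum_rank]. *)
Definition basis_vec (u : V) : 'rV[R]_#|V| := delta_mx ord0 (enum_rank u).

Definition sym_edge_polytope (e : rel V) : set 'rV[R]_#|V| :=
  conv_hull [set x | exists u w, e u w /\
    (x = basis_vec u - basis_vec w \/ x = basis_vec w - basis_vec u)].

Definition root_polytope (D : {set V * V}) : set 'rV[R]_#|V| :=
  conv_hull [set x | exists t h, (t, h) \in D /\ x = basis_vec h - basis_vec t].

Definition dissecting_tree_set (e : rel V) (TT : {set {set V * V}}) : Prop :=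
  [/\ forall T, T \in TT -> spanning_tree (bidirected e) T,
      forall T T', T \in TT -> T' \in TT -> T <> T' ->
        relative_interior (root_polytope T) `&`
          relative_interior (root_polytope T') = set0
    & \bigcup_(T in [set T | T \in TT]) root_polytope T =
        relative_boundary (sym_edge_polytope e)].

End GraphPolytopes.

Arguments basis_vec R {V} u.
Arguments sym_edge_polytope R {V} e.
Arguments root_polytope R {V} D.
Arguments dissecting_tree_set R {V} e TT.

Lemma has_dim_unique (R : realType) (n : nat) (S : set 'rV[R]_n) (d d' : nat) :
  has_dim S d -> has_dim S d' -> d = d'.
Proof.
suff sub (x y : 'rV[R]_n) (U W : {vspace 'rV[R]_n}) :
    affine_hull S = [set x + u | u in [set u | u \in U]] ->
    affine_hull S = [set y + u | u in [set u | u \in W]] -> (U <= W)%VS.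
  move=> [x [U [<- eU]]] [y [W [<- eW]]].
  by apply/eqP; rewrite eqn_leq !dimvS //; [exact: sub eW eU|exact: sub eU eW].
move=> -> eUW; apply/subvP => u uU.
have inW z : z \in U -> exists2 w, w \in W & y + w = x + z.
  move=> zU.
  have : [set x + u | u in [set u | u \in U]] (x + z) by exists z.
  by rewrite eUW => -[w wW <-]; exists w.
have [w wW ew] := inW u uU; have [w0 w0W ew0] := inW 0 (mem0v _).
have -> : u = w - w0.
  apply: (addrI x); rewrite -ew -[x in RHS]addr0 -ew0.
  by rewrite -addrA [w0 + _]addrC subrK.
exact: memvB.
Qed.

Lemma is_hstar_poly_unique (R : realType) (n : nat) (P : set 'rV[R]_n)
  (h h' : {poly R}) : is_hstar_poly P h -> is_hstar_poly P h' -> h = h'.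
Proof.
move=> [d [dP sh eh]] [d' [dP' sh' eh']].
have dd := has_dim_unique dP' dP; rewrite {}dd in sh' eh'.
apply/polyP; elim/ltn_ind => t IH.
have [td|dt] := ltnP t d.+1; last first.
  by rewrite !nth_default // (leq_trans _ dt).
have eX (g : {poly R}) : \sum_(k < d.+1) g`_k * 'C(t + d - k, d)%:R =
    g`_t + \sum_(k < d.+1 | k != Ordinal td) g`_k * 'C(t + d - k, d)%:R.
  by rewrite (bigD1 (Ordinal td)) //= addKn binn mulr1.
have := eh t; rewrite eh' (eX h) (eX h').
have -> : \sum_(k < d.+1 | k != Ordinal td) h'`_k * 'C(t + d - k, d)%:R =
    \sum_(k < d.+1 | k != Ordinal td) h`_k * 'C(t + d - k, d)%:R.
  apply: eq_bigr => i ne; have [/IH -> //|ti] := ltnP i t.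
  have {}ti : (t < i)%N by rewrite ltn_neqAle ti andbT eq_sym.
  rewrite bin_small ?mulr0 // ltn_subLR; first by rewrite ltn_add2r.
  by rewrite (leq_trans _ (leq_addl _ _)) // -ltnS.
by move/addIr.
Qed.

(* Main.v *)
From HB Require Import structures.
Require Import Defs.
From mathcomp Require Import ring lra zify.

Set Implicit Arguments.
Unset Strict Implicit.
Unset Printing Implicit Defensive.

Import Order.TTheory GRing.Theory Num.Theory.
Import numFieldTopology.Exports.

Local Open Scope classical_set_scope.
Local Open Scope ring_scope.

(** Since [0] is interior to the polytope [P], the cones over the simplices of the
    dissection subdivide the hyperplane of vectors with coordinate sum zero. The
    facet of the cone over [T] opposite to the arc [a] is cut out by the functional
    summing the coordinates over the shore of [T - a] containing the head of [a];
    these functionals are dual to the arc vectors of [T] and integral. Give the arc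
    [f] the weight [N ^ rank f] with [N] large, and let [q] be the weighted sum of
    the arc vectors: the sign of the functional at [q] is decided by the largest arc
    of the fundamental cut, and is negative exactly when [a] is semi-passive.
    Removing from every cone the facets visible from [q] partitions the hyperplane:
    a lattice point [x] lies in the half-open cone over [T] exactly when [M x + q]
    lies in the open cone, for [M] large. So the lattice points of [t P] correspond
    to pairs of a tree [T] and natural coefficients on its arcs with sum at most [t],
    positive on the [p] semi-passive arcs; there are ['C(t + d - p, d)] of these for
    each [T], with [d = #|T|]. *)

(** * Convex and affine hulls, and where a ray leaves a bounded set *)

Section Hulls.
Variables (R : realType) (n : nat).
Implicit Types (S : set 'rV[R]_n) (x y : 'rV[R]_n).

(** Frees the hull from ordinal indices: a family over any finite type is renumbered by [enum_val],
    so arcs, signs and disjoint sums can serve as indices. *)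
Lemma conv_hull_fin (I : finType) (A : pred I) (p : I -> 'rV[R]_n) (c : I -> R) S :
  (forall i, i \in A -> S (p i)) -> (forall i, i \in A -> 0 <= c i) ->
  \sum_(i in A) c i = 1 -> conv_hull S (\sum_(i in A) c i *: p i).
Proof.
move=> Sp c0 c1; exists #|A|, (fun i => p (enum_val i)), (fun i => c (enum_val i)).
split=> [i|i||]; last exact: big_enum_val.
- exact/Sp/enum_valP.
- exact/c0/enum_valP.
- by rewrite -(big_enum_val c).
Qed.

Lemma affine_hull_fin (I : finType) (A : pred I) (p : I -> 'rV[R]_n) (c : I -> R) S :
  (forall i, i \in A -> S (p i)) ->
  \sum_(i in A) c i = 1 -> affine_hull S (\sum_(i in A) c i *: p i).
Proof.
move=> Sp c1; exists #|A|, (fun i => p (enum_val i)), (fun i => c (enum_val i)).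
split=> [i||]; last exact: big_enum_val.
- exact/Sp/enum_valP.
- by rewrite -(big_enum_val c).
Qed.

Lemma sub_conv_hull S : S `<=` conv_hull S.
Proof.
move=> x Sx; have := @conv_hull_fin unit predT (fun=> x) (fun=> 1) S.
rewrite !big_const card_unit /= !addr0 scale1r; exact.
Qed.

Lemma conv_hull_convex S x y (t : R) : 0 <= t <= 1 ->
  conv_hull S x -> conv_hull S y -> conv_hull S (t *: x + (1 - t) *: y).
Proof.
move=> /andP[t0 t1] [k [p [c [Sp c0 c1 ->]]]] [l [p' [c' [Sp' c0' c1' ->]]]].
(* The two combinations are juxtaposed over a disjoint sum, their weights scaled by [t] and
   [1 - t]. *)
have := @conv_hull_fin ('I_k + 'I_l)%type predT
  (fun i => match i with inl j => p j | inr j => p' j end)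
  (fun i => match i with inl j => t * c j | inr j => (1 - t) * c' j end) S.
rewrite !big_sumType /= -!mulr_sumr c1 c1' !mulr1.
have eqs m (a : R) (g : 'I_m -> R) (v : 'I_m -> 'rV[R]_n) :
    \sum_i (a * g i) *: v i = a *: \sum_i g i *: v i.
  by rewrite scaler_sumr; apply: eq_bigr => i _; rewrite scalerA.
rewrite !eqs.
apply=> [[] j|[] j|] //; last by rewrite addrC subrK.
- by rewrite mulr_ge0.
- by rewrite mulr_ge0 // subr_ge0.
Qed.

Lemma affine_hull_line S x (r : R) : S x -> S (- x) -> affine_hull S (r *: x).
Proof.
move=> Sx SNx; have := @affine_hull_fin bool predT
  (fun b => if b then x else - x)
  (fun b => if b then (1 + r) / 2 else (1 - r) / 2) S.
rewrite !big_bool /= scalerN -scalerBl.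
have -> : (1 + r) / 2 - (1 - r) / 2 = r by field.
by apply=> [[]|] //; field.
Qed.

Lemma nbhs_coord x (P : set 'rV[R]_n) :
  nbhs x P <-> exists2 d : R, 0 < d &
    forall y, (forall j, `|y ord0 j - x ord0 j| < d) -> P y.
Proof.
rewrite nbhs_ballP; split=> [[d d0 dP]|[d d0 dP]]; exists d => // y.
  move=> xy; apply: dP; split=> // i j; rewrite ord1.
  by have := xy j; rewrite distrC.
by move=> [_ xy]; apply: dP => j; rewrite distrC; exact: xy.
Qed.

(* The supremum of the admissible scalings along the ray lands on the boundary
   whether or not [S] is closed. *)
Lemma ray_relative_boundary S x (B : R) :
  (forall y, S y -> forall j, `|y ord0 j| <= B) -> S 0 -> x != 0 ->
  (forall r, affine_hull S (r *: x)) ->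
  exists2 s, 0 <= s & relative_boundary S (s *: x).
Proof.
move=> bS S0 x0 aff.
have [j xj0] : exists j, x ord0 j != 0.
  apply/existsP; apply: contraNT x0; rewrite negb_exists => /forallP xj.
  by apply/eqP/rowP => j; rewrite mxE; apply/eqP; have := xj j; rewrite negbK.
(* The constant [K] strictly exceeds every [|x_i|], so changing the scaling by less than [d / K]
   moves each coordinate by less than [d]. *)
have Kp : 0 < 1 + \sum_i `|x ord0 i| by rewrite ltr_wpDr // sumr_ge0.
have Kx i : `|x ord0 i| < 1 + \sum_i `|x ord0 i|.
  rewrite (bigD1 i) //= addrCA ltrDl.
  by rewrite ltr_wpDr // sumr_ge0.
set K := 1 + _ in Kp Kx.
pose E : set R := [set s | S (s *: x)].
have E0 : E 0 by rewrite /E /= scale0r.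
have hE : has_sup E.
  split; first by exists 0.
  exists (B / `|x ord0 j|) => s /bS/(_ j); rewrite mxE normrM => sB.
  rewrite ler_pdivlMr ?normr_gt0 //; apply: le_trans sB.
  by rewrite ler_wpM2r ?ler_norm.
have ubE : ubound E (sup E) by exact: sup_upper_bound.
exists (sup E); first exact: ubE.
split.
  move=> U /nbhs_coord[d d0 dU].
  have [s Es ltE] := @sup_adherent R E (d / K) (divr_gt0 d0 Kp) hE.
  exists (s *: x); split=> //; apply: dU => i.
  rewrite !mxE -mulrBl normrM.
  have leE := ubE _ Es.
  have -> : d = (d / K) * K by rewrite divfK ?gt_eqF.
  apply: ltr_pM; rewrite ?Kx //.
  rewrite distrC ger0_norm ?subr_ge0 //; lra.
move=> [_ /nbhs_coord[d d0 dU]].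
have dK : 0 < d / K by rewrite divr_gt0.
(* At a relatively interior point the scaling could still grow by [d / K], beyond the supremum. *)
suff /ubE : E (sup E + d / K) by rewrite leNgt ltrDl dK.
apply: dU => // i; rewrite !mxE -mulrBl [_ + _ - _]addrC addKr normrM gtr0_norm //.
by rewrite -ltr_pdivlMl // invf_div divfK ?gt_eqF.
Qed.

End Hulls.

(** * The arcs of a spanning tree as a basis of the sum-zero hyperplane, with the shore sums as dual
    basis *)

Section Trees.
Variables (R : realType) (V : finType).
Implicit Types (D T : {set V * V}) (a b f : V * V) (u w : V).
Implicit Types (v x y : 'rV[R]_#|V|).

Definition arc_vec a : 'rV[R]_#|V| := basis_vec R a.2 - basis_vec R a.1.

(* When [a] belongs to the spanning tree [T], this is the linear functional that
   reads off the coefficient of [arc_vec a] in the basis of arcs of [T]. *)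
Definition shore_sum T a v : R :=
  \sum_(u | same_shore T a a.2 u) v ord0 (enum_rank u).

Lemma shore_sum_is_linear T a : scalar (shore_sum T a).
Proof.
move=> k x y; rewrite /shore_sum mulr_sumr -big_split /=.
by apply: eq_bigr => u _; rewrite !mxE.
Qed.

HB.instance Definition _ T a :=
  GRing.isLinear.Build R 'rV[R]_#|V| R *%R (shore_sum T a) (shore_sum_is_linear T a).

Lemma shore_sum_arc T a f : shore_sum T a (arc_vec f) =
  (same_shore T a a.2 f.2)%:R - (same_shore T a a.2 f.1)%:R.
Proof.
have basis w : shore_sum T a (basis_vec R w) = (same_shore T a a.2 w)%:R.
  rewrite /shore_sum; under eq_bigr do rewrite mxE eqxx (inj_eq enum_rank_inj) /=.
  have [sw|nsw] := boolP (same_shore T a a.2 w).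
    by rewrite (bigD1 w) //= eqxx big1 ?addr0 // => u /andP[_ /negPf ->].
  rewrite big1 // => u su; case: eqP => // uw.
  by rewrite -uw su in nsw.
by rewrite /arc_vec linearB /= !basis.
Qed.

Lemma adj_sym T : symmetric (adj T).
Proof. by move=> u w; rewrite /adj /= orbC. Qed.

Lemma same_shore_sym T a : symmetric (same_shore T a).
Proof. exact/sym_connect_sym/adj_sym. Qed.

Lemma adj_same_shore T a b : b \in T -> b != a -> same_shore T a b.1 b.2.
Proof.
by case: b => s t bT ba; apply/connect1; rewrite /adj /= !inE ba bT.
Qed.

Lemma tree_arc_separates D T a :
  spanning_tree D T -> a \in T -> ~~ same_shore T a a.2 a.1.
Proof.
case=> _ _ anti acyc; case: a => s h aT /=; apply/negP => /connectP[p pp].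
case/shortenP: pp => p' pp' up' _ /= ls.
have sub : subrel (adj (T :\ (s, h))%SET) (adj T).
  by move=> u w; rewrite /adj /= !inE => /orP[] /andP[_ ->]; rewrite ?orbT.
(* A simple path avoiding [a] between its ends closes up with [a] to a cycle. Acyclicity leaves only
   length 2, where the path is the arc antiparallel to [a]. *)
have /acyc : ucycle (adj T) (h :: p').
  rewrite /ucycle up' /= rcons_path -ls {2}/adj /= aT !andbT.
  by rewrite (sub_path sub).
rewrite /= eqSS; case: p' pp' ls {up'} => [|u [|? ?]] //=.
rewrite andbT => + su; rewrite -su /adj /= !inE eqxx /= orbF => /andP[_ hsT].
by have := anti _ _ aT; rewrite hsT.
Qed.

Lemma shore_sum_tree D T a b : spanning_tree D T -> a \in T -> b \in T ->
  shore_sum T a (arc_vec b) = (a == b)%:R.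
Proof.
move=> tT aT bT; rewrite shore_sum_arc; have [<-|ab] := eqVneq a b.
  by rewrite (negPf (tree_arc_separates tT aT)) /same_shore connect0 subr0.
rewrite eq_sym in ab; have sb := adj_same_shore bT ab.
by rewrite /same_shore (same_connect_r (same_shore_sym T a) sb) subrr.
Qed.

Lemma shore_sum_comb D T a (c : V * V -> R) : spanning_tree D T -> a \in T ->
  shore_sum T a (\sum_(b in T) c b *: arc_vec b) = c a.
Proof.
move=> tT aT; rewrite linear_sum (bigD1 a) //= linearZ /=.
rewrite (shore_sum_tree tT) // eqxx mulr1 big1 ?addr0 // => b /andP[bT ba].
by rewrite linearZ /= (shore_sum_tree tT) // eq_sym (negPf ba) mulr0.
Qed.

(** Along a path of [T] starting at the head of [a], every step other than [a] itself stays in its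
    shore, and a step along [a] lands on one of its two ends. *)
Lemma tree_two_shores D T a u : spanning_tree D T ->
  same_shore T a a.2 u || same_shore T a a.1 u.
Proof.
case=> _ con _ _; have /connectP[p pp ->] := con a.2 u.
elim/last_ind: p pp => [|p w IH]; first by rewrite /same_shore connect0.
rewrite rcons_path last_rcons => /andP[/IH {}IH].
set z := last _ _ in IH *; move=> zw.
have [/eqP/esym za|zNa] := boolP ((z, w) == a).
  by rewrite za /same_shore connect0.
have [/eqP/esym wa|wNa] := boolP ((w, z) == a).
  by rewrite wa /same_shore connect0 orbT.
have zw' : same_shore T a z w.
  by apply: connect1; rewrite /adj /= !inE zNa wNa.
by case/orP: IH => sz; apply/orP; [left|right]; exact: connect_trans zw'.
Qed.

(** This turns the combinatorial notion into a sign: an arc of the cut enters the head shore of [a]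
    when parallel and leaves it when opposite. *)
Lemma shore_sum_cut D T a f : spanning_tree D T -> a \in T ->
  ~~ same_shore T a f.1 f.2 ->
  shore_sum T a (arc_vec f) = if stands_opposite T a f then -1 else 1.
Proof.
move=> tT aT cf; rewrite shore_sum_arc /stands_opposite /stands_parallel.
have [s2|s2] := boolP (same_shore T a a.2 f.2) => /=.
  suff /negPf -> : ~~ same_shore T a a.2 f.1 by rewrite subr0.
  apply: contra cf; rewrite same_shore_sym => s1; exact: connect_trans s2.
suff -> : same_shore T a a.2 f.1 by rewrite sub0r.
apply: contraNT cf => s1.
have := tree_two_shores a f.1 tT; rewrite (negPf s1) /= => s1'.
have := tree_two_shores a f.2 tT; rewrite (negPf s2) /=.
by apply: connect_trans; rewrite -/(same_shore T a _ _) same_shore_sym.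
Qed.

Lemma shore_sum_nocut T a f : same_shore T a f.1 f.2 ->
  shore_sum T a (arc_vec f) = 0.
Proof.
move=> sf; rewrite shore_sum_arc /same_shore.
by rewrite (same_connect_r (same_shore_sym T a) sf) subrr.
Qed.

Definition coord_sum v : R := \sum_j v ord0 j.

Lemma coord_sum_is_linear : scalar coord_sum.
Proof.
move=> k x y; rewrite /coord_sum mulr_sumr -big_split /=.
by apply: eq_bigr => u _; rewrite !mxE.
Qed.

HB.instance Definition _ :=
  GRing.isLinear.Build R 'rV[R]_#|V| R *%R coord_sum coord_sum_is_linear.

Lemma coord_sum_arc a : coord_sum (arc_vec a) = 0.
Proof.
have basis w : coord_sum (basis_vec R w) = 1.
  rewrite /coord_sum (bigD1 (enum_rank w)) //= mxE !eqxx big1 ?addr0 // => j.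
  by rewrite mxE eqxx => /negPf ->.
by rewrite /arc_vec linearB /= !basis subrr.
Qed.

(** The vectors with this expansion form a subspace containing the arcs of [T], hence, by following
    tree paths, all differences of basis vectors; these span the hyperplane. *)
Lemma tree_expand D T v : spanning_tree D T -> coord_sum v = 0 ->
  v = \sum_(a in T) shore_sum T a v *: arc_vec a.
Proof.
move=> tT v0; pose good v := v = \sum_(a in T) shore_sum T a v *: arc_vec a.
have good0 : good 0 by rewrite /good big1 // => a _; rewrite linear0 scale0r.
have goodD x y : good x -> good y -> good (x + y).
  move=> gx gy; rewrite /good {1}gx {1}gy -big_split /=.
  by apply: eq_bigr => a _; rewrite [shore_sum T a (x + y)]linearD scalerDl.
have goodZ k x : good x -> good (k *: x).
  move=> gx; rewrite /good {1}gx scaler_sumr; apply: eq_bigr => a _.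
  by rewrite [shore_sum T a (k *: x)]linearZ scalerA.
have good_arc a : a \in T -> good (arc_vec a).
  move=> aT; rewrite /good (bigD1 a) //= (shore_sum_tree tT) // eqxx scale1r.
  rewrite big1 ?addr0 // => b /andP[bT ba].
  by rewrite (shore_sum_tree tT) // (negPf ba) scale0r.
have good_diff u w : good (basis_vec R u - basis_vec R w).
  case: (tT) => _ con _ _; have /connectP[p pp ->] := con w u.
  rewrite -[basis_vec R w]/(basis_vec R (last w [::])).
  elim/last_ind: p pp => [|p z IH] /=; first by rewrite subrr.
  rewrite rcons_path last_rcons => /andP[/IH {}IH].
  set l := last _ _ in IH *; move=> lz.
  rewrite -[basis_vec R z](subrK (basis_vec R l)) -addrA; apply: goodD IH.
  case/orP: lz => [/good_arc //|/good_arc/(goodZ (-1))].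
  by rewrite scaleN1r opprB.
rewrite -/(good v); have [r _|V0] := pickP (fun r : V => true); last first.
  suff -> : v = 0 by exact: good0.
  by apply/rowP => j; have := V0 (enum_val j).
(* Subtracting the root vector [r] from each basis vector costs nothing, since the coordinates of
   [v] sum to zero. *)
suff -> : v = \sum_u v ord0 (enum_rank u) *: (basis_vec R u - basis_vec R r).
  by apply: (big_ind good) => // u _; exact/goodZ/good_diff.
under eq_bigr do rewrite scalerBr.
rewrite big_split /= sumrN -scaler_suml.
have re (F : 'I_#|V| -> R) : \sum_u F (enum_rank u) = \sum_j F j.
  by rewrite [RHS](reindex enum_rank) //; exact: onW_bij (enum_rank_bij V).
rewrite re -/(coord_sum v) v0 scale0r oppr0 addr0 {1}[v]row_sum_delta.
rewrite [LHS](reindex (@enum_rank V)) //; exact: onW_bij (enum_rank_bij V).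
Qed.

Lemma norm_shore_sum T a v (eps : R) :
  (forall j, `|v ord0 j| <= eps) -> `|shore_sum T a v| <= #|V|%:R * eps.
Proof.
move=> ve; apply: le_trans (ler_norm_sum _ _ _) _.
rewrite mulr_natl -sumr_const.
apply: (@le_trans _ _ (\sum_(u : V) `|v ord0 (enum_rank u)|)).
  by rewrite [leRHS](bigID (same_shore T a a.2)) /= lerDl sumr_ge0.
by rewrite ler_sum.
Qed.

Lemma near_shore_sum x (eps : R) : 0 < eps ->
  \forall y \near x, forall T a, `|shore_sum T a (y - x)| < eps.
Proof.
(* The successor keeps the divisor positive when [V] is empty and makes the final bound strict. *)
move=> e0; apply/nbhs_coord; exists (eps / #|V|.+1%:R); first by rewrite divr_gt0.
move=> y xy T a; apply: (@le_lt_trans _ _ (#|V|%:R * (eps / #|V|.+1%:R))).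
  by apply: norm_shore_sum => j; rewrite !mxE ltW.
by rewrite mulrCA gtr_pMr // ltr_pdivrMr // mul1r ltr_nat.
Qed.

End Trees.

(** * Linear functionals on hulls *)

Section HullFunctionals.
Variables (R : realType) (n : nat) (phi : {scalar 'rV[R]_n}).
Implicit Types (S : set 'rV[R]_n).

Lemma affine_hull_const S (k : R) : (forall x, S x -> phi x = k) ->
  forall x, affine_hull S x -> phi x = k.
Proof.
move=> Sk x [m [p [c [Sp c1 ->]]]]; rewrite linear_sum /=.
under eq_bigr do rewrite linearZ /= Sk //.
by rewrite -mulr_suml c1 mul1r.
Qed.

Lemma conv_hull_ge0 S : (forall x, S x -> 0 <= phi x) ->
  forall x, conv_hull S x -> 0 <= phi x.
Proof.
move=> S0 x [m [p [c [Sp c0 c1 ->]]]]; rewrite linear_sum /=.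
by apply: sumr_ge0 => i _; rewrite linearZ /= mulr_ge0 ?S0.
Qed.

End HullFunctionals.

Lemma conv_sub_affine_hull (R : realType) (n : nat) (S : set 'rV[R]_n) :
  conv_hull S `<=` affine_hull S.
Proof. by move=> x [m [p [c [Sp _ c1 ->]]]]; exists m, p, c. Qed.

(** * The simplex of a tree and the cone over it *)

Section TreeSimplex.
Variables (R : realType) (V : finType).
Implicit Types (D T : {set V * V}) (a b f : V * V) (v x y : 'rV[R]_#|V|).

(** On the cone over a tree of the dissection this is the gauge of the symmetric edge polytope. *)
Definition tree_height T v : R := \sum_(a in T) shore_sum T a v.

Lemma tree_height_is_linear T : scalar (tree_height T).
Proof.
move=> k x y; rewrite /tree_height mulr_sumr -big_split /=.
by apply: eq_bigr => a _; rewrite linearP.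
Qed.

HB.instance Definition _ T :=
  GRing.isLinear.Build R 'rV[R]_#|V| R *%R (tree_height T) (tree_height_is_linear T).

Lemma tree_height_arc D T a : spanning_tree D T -> a \in T ->
  tree_height T (arc_vec R a) = 1.
Proof.
move=> tT aT; rewrite /tree_height (bigD1 a) //= (shore_sum_tree _ tT) // eqxx.
rewrite big1 ?addr0 // => b /andP[bT ba].
by rewrite (shore_sum_tree _ tT) // (negPf ba).
Qed.

Definition in_cone T y : Prop :=
  coord_sum y = 0 /\ forall a, a \in T -> 0 <= shore_sum T a y.

Definition in_open_cone T y : Prop :=
  coord_sum y = 0 /\ forall a, a \in T -> 0 < shore_sum T a y.

Lemma in_open_coneW T y : in_open_cone T y -> in_cone T y.
Proof. by case=> y0 yT; split=> // a /yT/ltW. Qed.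

Lemma tree_height_ge0 T y : in_cone T y -> 0 <= tree_height T y.
Proof. by case=> _ yT; apply: sumr_ge0. Qed.

Lemma affine_root_polytope D T y : spanning_tree D T ->
  affine_hull (root_polytope R T) y -> coord_sum y = 0 /\ tree_height T y = 1.
Proof.
move=> tT aQ; split; apply: affine_hull_const aQ => x /conv_sub_affine_hull; move: x.
- apply: affine_hull_const => _ [t [h [_ ->]]].
  exact: (coord_sum_arc R (t, h)).
- apply: affine_hull_const => _ [t [h [thT ->]]].
  exact: (@tree_height_arc D T (t, h)).
Qed.

(** The shore sums are the barycentric coordinates of the simplex. *)
Lemma root_polytopeP D T y : spanning_tree D T ->
  root_polytope R T y <-> in_cone T y /\ tree_height T y = 1.
Proof.
move=> tT; split=> [Qy|[[y0 yT] y1]].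
  have [|y0 y1] := @affine_root_polytope D T y tT.
    exact/conv_sub_affine_hull/sub_conv_hull.
  split=> //; split=> // a aT; apply: conv_hull_ge0 Qy => _ [t [h [thT ->]]].
  rewrite -[X in _ <= X]/(shore_sum T a (arc_vec R (t, h))).
  by rewrite (shore_sum_tree _ tT) // ler0n.
rewrite (tree_expand tT y0); apply: conv_hull_fin => // -[t h] thT.
by exists t, h.
Qed.

Lemma relint_root_polytope D T y : spanning_tree D T ->
  in_open_cone T y -> tree_height T y = 1 ->
  relative_interior (root_polytope R T) y.
Proof.
move=> tT oy y1; split.
  by apply/(root_polytopeP _ tT); split; [exact: in_open_coneW|].
have [y0 yT] := oy.
(* The margin by which every barycentric coordinate may move; the default 1 keeps it positive for an
   empty tree. *)
pose m := \big[Num.min/1]_(a in T) shore_sum T a y.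
have m0 : 0 < m.
  by rewrite /m; elim/big_ind: _ => // p q; rewrite lt_min => -> ->.
have my a : a \in T -> m <= shore_sum T a y.
  by move=> aT; rewrite /m (bigD1 a) //= ge_min lexx.
apply: filterS (near_shore_sum y m0) => z zy /(affine_root_polytope tT)[z0 z1].
apply/(root_polytopeP _ tT); split=> //; split=> // a aT.
have := zy T a; rewrite linearB /= ltr_norml => /andP[+ _].
rewrite ltrNl opprB ltrBlDr => mz.
by have := my _ aT; lra.
Qed.

End TreeSimplex.

(** * The symmetric edge polytope near the origin and along rays *)

Section SymEdgePolytope.
Variables (R : realType) (V : finType) (e : rel V).
Implicit Types (T : {set V * V}) (a b f : V * V) (x y p : 'rV[R]_#|V|).
Let P := sym_edge_polytope R e.
Let D := bidirected e.

Lemma sym_edge_polytope_opp f :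
  f \in D -> P (arc_vec R f) /\ P (- arc_vec R f).
Proof.
rewrite inE => ef; split; apply: sub_conv_hull; exists f.1, f.2; split=> //.
  by right.
by left; rewrite opprB.
Qed.

Lemma sym_edge_polytope0 f : f \in D -> P 0.
Proof.
move=> /sym_edge_polytope_opp[Pf PNf].
suff -> : 0 = (1 / 2) *: arc_vec R f + (1 - 1 / 2) *: - arc_vec R f.
  by apply: conv_hull_convex => //; apply/andP; split; lra.
rewrite scalerN -scalerBl; have -> : 1 / 2 - (1 - 1 / 2) = 0 :> R by lra.
by rewrite scale0r.
Qed.

Lemma sym_edge_polytope_bounded y : P y -> forall j, `|y ord0 j| <= 1.
Proof.
move=> [m [p [c [Sp c0 c1 ->]]]] j; rewrite summxE -c1.
apply: le_trans (ler_norm_sum _ _ _) _; apply: ler_sum => i _.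
rewrite mxE normrM ger0_norm // ler_piMr //.
have bd u w : `|(basis_vec R u - basis_vec R w) ord0 j| <= 1.
  by rewrite !mxE eqxx /= !(fun_if, if_same); do 2! case: eqP => _;
     rewrite ?subrr ?subr0 ?sub0r ?normrN ?normr1 ?normr0.
by have [u [w [_ [] ->]]] := Sp i.
Qed.

Lemma affine_sym_edge_sum y : affine_hull P y -> coord_sum y = 0.
Proof.
apply: affine_hull_const => x /conv_sub_affine_hull; move: x.
apply: affine_hull_const => _ [u [w [_ []]]] ->.
  exact: (coord_sum_arc R (w, u)).
exact: (coord_sum_arc R (u, w)).
Qed.

Lemma sym_edge_scale p (t : R) : P 0 -> P p -> 0 <= t <= 1 -> P (t *: p).
Proof.
move=> P0 Pp t01; rewrite -[t *: p]addr0 -(scaler0 _ (1 - t)).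
exact: conv_hull_convex.
Qed.

Section WithTree.
Variable T : {set V * V}.
Hypotheses (tT : spanning_tree D T) (T0 : T != finset.set0).

Let tree_arc_in a : a \in T -> a \in D.
Proof. by case: tT => /fintype.subsetP TD _ _ _ /TD. Qed.

Let card_gt0 : 0 < #|T|%:R :> R.
Proof. by rewrite ltr0n card_gt0. Qed.

(* Weights of [arc_vec a] and [- arc_vec a] that add up to [1 / #|T|] for each
   arc [a], and whose difference is [c a]. *)
Let weight (c : V * V -> R) (i : (V * V) * bool) : R :=
  (#|T|%:R^-1 + (if i.2 then c i.1 else - c i.1)) / 2.
Let vertex (i : (V * V) * bool) : 'rV[R]_#|V| :=
  if i.2 then arc_vec R i.1 else - arc_vec R i.1.

Let sum_weight c : \sum_(i in [pred i | i.1 \in T]) weight c i = 1.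
Proof.
rewrite (eq_bigl (fun i : (V * V) * bool => (i.1 \in T) && true)); last first.
  by move=> i; rewrite inE andbT.
rewrite -(pair_big (fun a => a \in T) predT (fun a (b : bool) => weight c (a, b))) /=.
rewrite (eq_bigr (fun=> #|T|%:R^-1)).
  by rewrite sumr_const -[LHS]mulr_natr mulVf ?gt_eqF.
by move=> a _; rewrite big_bool /weight /=; lra.
Qed.

Let sum_vertex c : \sum_(i in [pred i | i.1 \in T]) weight c i *: vertex i =
  \sum_(a in T) c a *: arc_vec R a.
Proof.
rewrite (eq_bigl (fun i : (V * V) * bool => (i.1 \in T) && true)); last first.
  by move=> i; rewrite inE andbT.
rewrite -(pair_big (fun a => a \in T) predT
  (fun a (b : bool) => weight c (a, b) *: vertex (a, b))) /=.
apply: eq_bigr => a _; rewrite big_bool /weight /vertex /= scalerN -scalerBl.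
by congr (_ *: _); lra.
Qed.

Let vertex_in i : i \in [pred i | i.1 \in T] -> P (vertex i).
Proof.
by case: i => a [] /tree_arc_in/sym_edge_polytope_opp[].
Qed.

Lemma affine_sym_edge_polytope y : affine_hull P y <-> coord_sum y = 0.
Proof.
split=> [|y0]; first exact: affine_sym_edge_sum.
by rewrite (tree_expand tT y0) -sum_vertex; apply: affine_hull_fin.
Qed.

(** This is a neighbourhood of 0 in the hyperplane: each arc of [T] receives total weight
    [1 / #|T|], shared with its opposite so that the difference is the required coefficient. *)
Lemma sym_edge_polytope_small y : coord_sum y = 0 ->
  (forall a, a \in T -> `|shore_sum T a y| <= #|T|%:R^-1) -> P y.
Proof.
move=> y0 ys; rewrite (tree_expand tT y0) -sum_vertex.
apply: conv_hull_fin => // -[a b] /= aT; last first.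
  have := ys a aT; rewrite ler_norml /weight /= => /andP[l u].
  by case: b {aT} => /=; lra.
have := tree_arc_in aT; rewrite inE => ea; exists a.1, a.2; split=> //.
by case: b {aT ea}; rewrite /vertex /=; [right|left; rewrite opprB].
Qed.

(** A nearby point is a convex combination of [p] and [(y - t p) / (1 - t)], and the latter is small
    enough to lie in the polytope. *)
Lemma relint_scale p (t : R) : P p -> 0 <= t < 1 -> relative_interior P (t *: p).
Proof.
move=> Pp /andP[t0 t1].
have P0 : P 0.
  by apply: sym_edge_polytope_small => [|a _]; rewrite linear0 ?normr0 ?invr_ge0 ?ler0n.
split; first by apply: sym_edge_scale; rewrite // t0 ltW.
have t1' : 0 < 1 - t by rewrite subr_gt0.
have eps0 : 0 < (1 - t) / #|T|%:R by rewrite divr_gt0.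
apply: filterS (near_shore_sum (t *: p) eps0) => y ny /affine_sym_edge_sum y0.
have p0 : coord_sum p = 0 by apply/affine_sym_edge_sum/conv_sub_affine_hull/sub_conv_hull.
have -> : y = t *: p + (1 - t) *: ((1 - t)^-1 *: (y - t *: p)).
  by rewrite scalerA divff ?gt_eqF // scale1r addrC subrK.
apply: conv_hull_convex => //; first by rewrite t0 ltW.
apply: sym_edge_polytope_small => [|a aT].
  by rewrite linearZ /= linearB /= linearZ /= p0 y0 mulr0 subrr mulr0.
rewrite linearZ /= normrM gtr0_norm ?invr_gt0 // ler_pdivrMl //.
exact/ltW/ny.
Qed.

End WithTree.

(** * The cones over a dissection cover the hyperplane, with disjoint open cones *)

Section Dissection.
Variables (TT : {set {set V * V}}).
Hypotheses (irr : irreflexive e) (edge : exists u v, e u v).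
Hypothesis dTT : dissecting_tree_set R e TT.

Lemma arc_vec_neq0 f : f \in D -> arc_vec R f != 0.
Proof.
rewrite inE; case: f => u w /= uw; apply/eqP => /rowP/(_ (enum_rank w)).
rewrite !mxE !eqxx (inj_eq enum_rank_inj).
case: eqP => [wu|_] /=; first by rewrite wu irr in uw.
by rewrite subr0 => /eqP; rewrite oner_eq0.
Qed.

Lemma spanning_tree_neq0 T : spanning_tree D T -> T != finset.set0.
Proof.
move=> tT; have [u [v uv]] := edge.
have : arc_vec R (u, v) != 0 by apply: arc_vec_neq0; rewrite inE.
apply: contraNneq => T0; rewrite (tree_expand tT (coord_sum_arc R (u, v))).
by rewrite T0 big_set0.
Qed.

Lemma dissecting_tree T : T \in TT -> spanning_tree D T.
Proof. by case: dTT => tTT _ _ /tTT. Qed.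

(** The ray along an arc vector meets the relative boundary, which the simplices cover. *)
Lemma dissecting_neq0 : exists T, T \in TT.
Proof.
have [u [v uv]] := edge; have uvD : (u, v) \in D by rewrite inE.
have [Pf PNf] := sym_edge_polytope_opp uvD.
have [s _] := ray_relative_boundary sym_edge_polytope_bounded
  (sym_edge_polytope0 uvD) (arc_vec_neq0 uvD)
  (fun r => affine_hull_line r Pf PNf).
by case: dTT => _ _ <- [T TTT _]; exists T.
Qed.

Lemma sym_edge_polytope_0 : P 0.
Proof.
by have [u [v uv]] := edge; apply: (@sym_edge_polytope0 (u, v)); rewrite inE.
Qed.

Lemma tree_height_gt0 T y : T \in TT -> in_open_cone T y -> 0 < tree_height T y.
Proof.
move=> TTT [_ yT]; have /set0Pn[a aT] := spanning_tree_neq0 (dissecting_tree TTT).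
rewrite /tree_height (bigD1 a) //= ltr_wpDr ?yT //.
by apply: sumr_ge0 => b /andP[bT _]; exact/ltW/yT.
Qed.

Lemma root_polytope_normalize T y : T \in TT -> in_cone T y ->
  0 < tree_height T y -> root_polytope R T ((tree_height T y)^-1 *: y).
Proof.
move=> TTT [y0 yT] h0; apply/(root_polytopeP _ (dissecting_tree TTT)); split.
  split=> [|a aT]; rewrite linearZ /= ?y0 ?mulr0 // mulr_ge0 ?yT //.
  by rewrite invr_ge0 ltW.
by rewrite linearZ /= mulVf ?gt_eqF.
Qed.

(** Otherwise the point of height 1 on the ray would be both a boundary point, lying in the simplex
    of [T], and a multiple of [p] by a factor below 1, hence relatively interior. *)
Lemma tree_height_le T p (t : R) : T \in TT -> P p -> 0 <= t ->
  in_cone T (t *: p) -> tree_height T (t *: p) <= t.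
Proof.
move=> TTT Pp t0 cp; rewrite leNgt; apply/negP => tlt.
have h0 := le_lt_trans t0 tlt; have tT := dissecting_tree TTT.
have Q := root_polytope_normalize TTT cp h0.
have : relative_boundary P ((tree_height T (t *: p))^-1 *: (t *: p)).
  by case: dTT => _ _ <-; exists T.
case=> _; apply; rewrite scalerA; apply: (relint_scale tT) => //.
  exact: spanning_tree_neq0.
by rewrite mulr_ge0 ?invr_ge0 ?(ltW h0) //= ltr_pdivrMl // mulr1.
Qed.

Lemma in_cone_polytope T y (t : R) : T \in TT -> in_cone T y ->
  tree_height T y <= t -> exists2 p, P p & t *: p = y.
Proof.
move=> TTT cy yt; have h0 := tree_height_ge0 cy; have tT := dissecting_tree TTT.
(* Height 0 forces [y = 0]; it is treated apart because [t] may then be 0 and cannot be divided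
   by. *)
have [h0'|h0'] := eqVneq (tree_height T y) 0.
  exists 0; first exact: sym_edge_polytope_0.
  rewrite scaler0; case: (cy) => y0 yT; rewrite (tree_expand tT y0) big1 // => a aT.
  by rewrite (psumr_eq0P _ h0') // scale0r.
have {h0 h0'} hp : 0 < tree_height T y by rewrite lt_def h0'.
have tp := lt_le_trans hp yt.
exists ((tree_height T y / t) *: ((tree_height T y)^-1 *: y)).
  apply: sym_edge_scale; first exact: sym_edge_polytope_0.
    have Qy := root_polytope_normalize TTT cy hp.
    case: Qy => k [q [c [Sq c0 c1 ->]]]; exists k, q, c; split=> // i.
    have [u [w [uwT ->]]] := Sq i; exists u, w; split; last by right.
    by case: tT => /fintype.subsetP/(_ _ uwT) + _ _ _; rewrite inE.
  by rewrite divr_ge0 ?(ltW hp) ?(ltW tp) //= ler_pdivrMr // mul1r.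
rewrite !scalerA -[RHS]scale1r; congr (_ *: _).
by field; rewrite !gt_eqF.
Qed.

(** The point where the ray of [y] meets the boundary lies in some simplex, and membership in a cone
    is invariant under positive scaling. *)
Lemma dissecting_cover y : coord_sum y = 0 -> y != 0 ->
  exists2 T, T \in TT & in_cone T y.
Proof.
move=> y0 yn0; have [T0 T0TT] := dissecting_neq0.
have tT0 := dissecting_tree T0TT; have T0n := spanning_tree_neq0 tT0.
have aff r : affine_hull P (r *: y).
  by apply/(affine_sym_edge_polytope tT0 T0n); rewrite linearZ /= y0 mulr0.
have [s s0 bs] := ray_relative_boundary sym_edge_polytope_bounded
  sym_edge_polytope_0 yn0 aff.
have sp : 0 < s.
  rewrite lt_def s0 andbT; apply/eqP => s00; case: bs => _; apply.
  rewrite s00 scale0r -(scaler0 _ 0).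
  by apply: (relint_scale tT0 T0n sym_edge_polytope_0); rewrite lexx ltr01.
move: bs; case: dTT => _ _ <- [T TTT].
move=> /(root_polytopeP _ (dissecting_tree TTT))[[_ yT] _]; exists T => //.
by split=> // a /yT; rewrite linearZ /= pmulr_rge0.
Qed.

(** Both heights of [y] equal the gauge of the polytope, so normalizing by either gives the same
    point, common to the two relative interiors. *)
Lemma dissecting_unique T T' y : T \in TT -> T' \in TT ->
  in_open_cone T y -> in_open_cone T' y -> T = T'.
Proof.
wlog hle : T T' / tree_height T y <= tree_height T' y.
  move=> IH TTT TTT' oT oT'; have [h|/ltW h] := leP (tree_height T y) (tree_height T' y).
    exact: IH.
  by apply/esym; exact: IH.
move=> TTT TTT' oT oT'; apply: contrapT => neq.
have hT := tree_height_gt0 TTT oT; have hT' := tree_height_gt0 TTT' oT'.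
have [p Pp py] := in_cone_polytope TTT (in_open_coneW oT) (lexx _).
have hge : tree_height T' y <= tree_height T y.
  rewrite -{1}py; apply: tree_height_le => //; first exact: ltW.
  by rewrite py; exact: in_open_coneW.
have hE : tree_height T y = tree_height T' y by apply/eqP; rewrite eq_le hle.
have oZ U : in_open_cone U y -> 0 < tree_height U y ->
    in_open_cone U ((tree_height U y)^-1 *: y).
  case=> y0 yU h0; split=> [|a aU]; rewrite linearZ /= ?y0 ?mulr0 //.
  by rewrite mulr_gt0 ?invr_gt0 ?yU.
have ri U : U \in TT -> in_open_cone U y -> 0 < tree_height U y ->
    relative_interior (root_polytope R U) ((tree_height U y)^-1 *: y).
  move=> UTT oU h0; apply: (relint_root_polytope (dissecting_tree UTT)).
    exact: oZ.
  by rewrite linearZ /= mulVf ?gt_eqF.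
case: dTT => _ /(_ _ _ TTT TTT' neq) dis _.
suff : set0 ((tree_height T y)^-1 *: y) by [].
by rewrite -dis; split; [|rewrite hE]; exact: ri.
Qed.

End Dissection.
End SymEdgePolytope.

(** * The dimension of the hyperplane and the common size of spanning trees *)

Section TreeSpace.
Variables (R : realType) (V : finType) (D : {set V * V}).
Implicit Types (T : {set V * V}) (v : 'rV[R]_#|V|).

Definition tree_basis T := [tuple arc_vec R (@enum_val _ (mem T) i) | i < #|T|].

Lemma mem_tree_span T v : spanning_tree D T ->
  (v \in <<tree_basis T>>%VS) = (coord_sum v == 0).
Proof.
move=> tT; apply/idP/eqP => [/coord_span ->|v0].
  rewrite linear_sum big1 // => i _; rewrite -tnth_nth tnth_mktuple linearZ /=.
  by rewrite coord_sum_arc mulr0.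
rewrite (tree_expand tT v0) big_enum_val memv_suml // => i _.
apply/memvZ/memv_span.
by rewrite -(tnth_mktuple (fun i => arc_vec R (enum_val i))) mem_tnth.
Qed.

Lemma dim_tree_span T : spanning_tree D T -> \dim <<tree_basis T>>%VS = #|T|.
Proof.
(* Independence: applying the dual functional of an arc to a vanishing combination reads off its
   coefficient. *)
move=> tT; suff /eqP -> : free (tree_basis T) by rewrite size_tuple.
apply/freeP => k k0 i; pose c a := k (enum_rank_in (enum_valP i) a).
have cE j : c (enum_val j) = k j by rewrite /c enum_valK_in.
rewrite -cE -(shore_sum_comb c tT (enum_valP i)) big_enum_val.
rewrite (eq_bigr (fun j => k j *: (tree_basis T)`_j)) ?k0 ?linear0 // => j _.
by rewrite cE -tnth_nth tnth_mktuple.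
Qed.

Lemma card_spanning_tree T T' :
  spanning_tree D T -> spanning_tree D T' -> #|T| = #|T'|.
Proof.
move=> tT tT'; rewrite -(dim_tree_span tT) -(dim_tree_span tT').
by congr (\dim _); apply/vspaceP => v; rewrite !mem_tree_span.
Qed.

End TreeSpace.

(** * Counting natural coefficients with bounded sum that are positive on a given subset *)

Lemma card_dominating_ffun (I : finType) (A S : {set I}) (t : nat) :
  S \subset A ->
  #|[set c : {ffun I -> 'I_t.+1} |
      [forall a, if a \in A then (a \in S) <= c a else c a == ord0] &&
      (\sum_(a in A) c a <= t)]%SET|%N = 'C(t + #|A| - #|S|, #|A|).
Proof.
move=> SA; have leSA := subset_leq_card SA.
have sumS : (\sum_(a in A) (a \in S) = #|S|)%N.
  rewrite -sum1_card [RHS]big_mkcond /= big_mkcond /=; apply: eq_bigr => a _.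
  by have := fintype.subsetP SA a; case: (a \in S) => [->|_]; rewrite ?if_same.
set X := [set c | _]%SET.
(* With fewer than [#|S|] units available there is no solution, and the upper index of the binomial
   drops below [#|A|]. *)
have [lt|le] := ltnP t #|S|.
  rewrite bin_small; last by rewrite ltn_subLR; lia.
  apply/eqP; rewrite cards_eq0; apply/set0Pn => -[c]; rewrite inE.
  case/andP=> /forallP cA; apply/negP; rewrite -ltnNge; apply: leq_trans lt _.
  by rewrite -sumS; apply: leq_sum => a aA; have := cA a; rewrite aA.
(* Taking one unit away from each element of [S] leaves arbitrary [#|A|]-tuples of sum at most [m];
   [G] is the inverse map, with zeros outside [A]. *)
pose m := (t - #|S|)%N.
pose gval (tau : #|A|.-tuple 'I_m.+1) a :=
  (if a \in A then nth ord0 tau (index a (enum A)) + (a \in S) else 0)%N.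
have gval_enum tau (i : 'I_#|A|) :
    gval tau (enum_val i) = (tnth tau i + (enum_val i \in S))%N.
  rewrite /gval enum_valP (enum_val_nth (enum_val i)) index_uniq ?enum_uniq -?cardE //.
  by rewrite (tnth_nth ord0).
have gval_lt tau a : (gval tau a < t.+1)%N.
  rewrite /gval; case: ifP => // aA; have := ltn_ord (nth ord0 tau (index a (enum A))).
  have [aS|] := boolP (a \in S); rewrite /m; last lia.
  have : (0 < #|S|)%N by apply/card_gt0P; exists a.
  by lia.
have sum_gval tau : (\sum_(a in A) gval tau a = \sum_(i <- tau) i + #|S|)%N.
  rewrite big_enum_val (eq_bigr _ (fun i _ => gval_enum tau i)) big_split /=.
  by rewrite big_tuple; congr addn; rewrite -sumS [RHS]big_enum_val.
pose G tau := [ffun a => Ordinal (gval_lt tau a)] : {ffun I -> 'I_t.+1}.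
have Ginj : injective G.
  move=> tau tau' /ffunP eqG; apply: eq_from_tnth => i; apply/val_inj/eqP.
  have := congr1 val (eqG (enum_val i)); rewrite !ffunE /= !gval_enum => /eqP.
  by rewrite eqn_add2r.
have -> : X = [set G tau | tau in
    [set tau : #|A|.-tuple 'I_m.+1 | (\sum_(i <- tau) i <= m)%N]]%SET.
  apply/setP => c; rewrite inE; apply/idP/imsetP => [|[tau]].
    case/andP=> /forallP cA cs.
    pose tau := [tuple inord (c (@enum_val _ (mem A) i) - (enum_val i \in S))
                   : 'I_m.+1 | i < #|A|].
    have dom a : a \in A -> ((a \in S) <= c a)%N by move=> aA; have := cA a; rewrite aA.
    have sum_sub : (\sum_(a in A) (c a - (a \in S)) <= m)%N.
      by rewrite sumnB // sumS /m leq_sub2r.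
    have tauE i : tnth tau i = (c (enum_val i) - (enum_val i \in S))%N :> nat.
      rewrite tnth_mktuple inordK // ltnS; apply: leq_trans sum_sub.
      by rewrite (bigD1 (enum_val i)) ?enum_valP //= leq_addr.
    exists tau.
      rewrite inE big_tuple (eq_bigr _ (fun i _ => tauE i)).
      by rewrite -(big_enum_val (fun a => c a - (a \in S))%N).
    apply/ffunP => a; apply/val_inj; rewrite ffunE /=.
    have [aA|aA] := boolP (a \in A); last first.
      by have := cA a; rewrite /gval (negPf aA) => /eqP ->.
    rewrite -(enum_rankK_in aA aA) gval_enum tauE subnK // dom //.
    by rewrite enum_rankK_in.
  rewrite inE => taum ->; apply/andP; split; last first.
    under eq_bigr do rewrite ffunE /=.
    by rewrite sum_gval addnC -leq_subRL.
  apply/forallP => a; rewrite ffunE -val_eqE /= /gval.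
  by case: (a \in A); rewrite // leq_addl.
rewrite card_imset // card_partial_ord_partitions; congr 'C(_, _).
by rewrite /m; lia.
Qed.

(** * The generic vector and the half-open cones it defines *)

Section GenericVector.
Variables (R : realType) (V : finType) (D : {set V * V}) (le : rel (V * V)).
Hypothesis ord : total_order_on D le.
Implicit Types (T C : {set V * V}) (a f g : V * V) (x : 'rV[R]_#|V|).

(** Turns the order into exponents for the weights. *)
Definition arc_rank f := #|[set g in D | le g f]%SET|.

Lemma arc_rank_lt f g : f \in D -> g \in D -> le g f -> g != f ->
  (arc_rank g < arc_rank f)%N.
Proof.
case: ord => refl anti trans _ fD gD gf ngf; apply: proper_card.
apply/properP; split; last first.
  exists f; rewrite !inE fD /=; first exact: refl.
  by apply: contraNN ngf => fg; apply/eqP; apply: anti; rewrite ?gf.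
apply/fintype.subsetP => h; rewrite !inE => /andP[hD hg]; rewrite hD.
exact: trans hg gf.
Qed.

Lemma is_max_exists C : C \subset D -> C != finset.set0 ->
  exists f, is_max_of le C f.
Proof.
move=> /fintype.subsetP CD /set0Pn[a aC].
have [f fC fmax] := @arg_maxnP _ a (fun f => f \in C) arc_rank aC.
exists f; rewrite /is_max_of fC; apply/forallP => g; apply/implyP => gC.
have [refl anti trans tot] := ord.
have [//|fg] := orP (tot g f (CD _ gC) (CD _ fC)).
have [->|nfg] := eqVneq g f; first exact/refl/CD.
have := arc_rank_lt (CD _ gC) (CD _ fC) fg; rewrite eq_sym => /(_ nfg).
by rewrite ltnNge => /negP[]; exact: fmax.
Qed.

(* The weights grow so fast along the order that the largest arc of a cut
   decides the sign of the corresponding [shore_sum]. *)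
Definition generic_vec : 'rV[R]_#|V| :=
  \sum_(f in D) (#|D|.+1 ^ arc_rank f)%N%:R *: arc_vec R f.

Lemma coord_sum_generic_vec : coord_sum generic_vec = 0.
Proof.
by rewrite linear_sum big1 // => f _; rewrite linearZ /= coord_sum_arc mulr0.
Qed.

Lemma shore_sum_generic_vec T a : spanning_tree D T -> a \in T ->
  shore_sum T a generic_vec != 0 /\
  (shore_sum T a generic_vec < 0) = semi_passive D le T a.
Proof.
move=> tT aT; have [/fintype.subsetP TD _ _ _] := tT.
set C := fundamental_cut D T a.
have CD : C \subset D by apply/fintype.subsetP => f; rewrite inE => /andP[].
have [|f fmax] := is_max_exists CD.
  apply/set0Pn; exists a; rewrite inE TD //= same_shore_sym.
  exact: tree_arc_separates tT aT.
have /andP[fC /forallP fge] := fmax.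
have [fD fcut] : f \in D /\ ~~ same_shore T a f.1 f.2.
  by move: fC; rewrite inE => /andP[].
have -> : semi_passive D le T a = stands_opposite T a f.
  rewrite /semi_passive aT /=; apply/existsP/idP => [[g /andP[gmax og]]|of_].
    suff -> : f = g by [].
    have /andP[gC /forallP gge] := gmax.
    have [_ anti _ _] := ord; apply: anti => //.
    - by move: gC; rewrite inE => /andP[].
    - by rewrite (implyP (gge f)) // (implyP (fge g)).
  by exists f; rewrite fmax.
pose w g : R := (#|D|.+1 ^ arc_rank g)%N%:R.
pose rest := \sum_(g in D | g != f) w g * shore_sum T a (arc_vec R g).
have qE : shore_sum T a generic_vec =
    w f * (if stands_opposite T a f then -1 else 1) + rest.
  rewrite linear_sum (bigD1 f) //= linearZ /= (shore_sum_cut _ tT) //.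
  by congr (_ + _); apply: eq_bigr => g _; rewrite linearZ.
have rank_gt0 : (0 < arc_rank f)%N.
  apply/card_gt0P; exists f; rewrite inE fD /=.
  by case: ord => refl _ _ _; exact: refl.
have D1 : (1 < #|D|.+1)%N by rewrite ltnS; apply/card_gt0P; exists f.
(* Arcs outside the cut contribute 0, and the others rank below [f]. So the rest is at most [#|D|]
   times [N ^ (arc_rank f - 1)] with [N = #|D| + 1], short of [N ^ arc_rank f]. *)
have rest_lt : `|rest| < w f.
  apply: (@le_lt_trans _ _ (\sum_(g in D | g != f) (#|D|.+1 ^ (arc_rank f).-1)%N%:R)).
    apply: le_trans (ler_norm_sum _ _ _) _; apply: ler_sum => g /andP[gD gf].
    have [sg|ng] := boolP (same_shore T a g.1 g.2).
      by rewrite shore_sum_nocut // mulr0 normr0 ler0n.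
    rewrite normrM (shore_sum_cut _ tT) //.
    rewrite (_ : `|if _ then _ else _| = 1); last by case: ifP; rewrite ?normrN normr1.
    rewrite mulr1 normr_nat ler_nat leq_exp2l // -ltnS prednK //.
    apply: arc_rank_lt => //; apply: (implyP (fge g)).
    by rewrite inE gD.
  apply: (@le_lt_trans _ _ (\sum_(g in D) (#|D|.+1 ^ (arc_rank f).-1)%N%:R)).
    by rewrite [leRHS](bigD1 f) //= lerDr ler0n.
  rewrite sumr_const -mulrnA ltr_nat /w.
  by rewrite -[X in (_ < _ ^ X)%N](prednK rank_gt0) expnS mulnC ltn_pmul2r ?expn_gt0.
rewrite qE; move: rest_lt; rewrite ltr_norml => /andP[lo hi].
case: ifP => _; split.
- by rewrite lt_eqF //; lra.
- by apply/idP; lra.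
- by rewrite gt_eqF //; lra.
- by apply/negbTE; rewrite -leNgt; lra.
Qed.

Definition generic_bound : R := 1 + #|V|%:R * \sum_j `|generic_vec ord0 j|.

Lemma generic_boundP T a : `|shore_sum T a generic_vec| < generic_bound.
Proof.
apply: (@le_lt_trans _ _ (#|V|%:R * \sum_j `|generic_vec ord0 j|)).
  by apply: norm_shore_sum => j; rewrite (bigD1 j) //= lerDl sumr_ge0.
by rewrite ltrDr ltr01.
Qed.

(* The points of the cone of [T] that remain when the facets visible from
   [generic_vec] are removed. *)
Definition in_half_open_cone T x : Prop :=
  coord_sum x = 0 /\
  forall a, a \in T -> (semi_passive D le T a)%:R <= shore_sum T a x.

Lemma half_open_coneW T x : in_half_open_cone T x -> in_cone T x.
Proof. by case=> x0 xT; split=> // a /xT; exact/le_trans/ler0n. Qed.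

Lemma int_shore_sum T a x : lattice x -> shore_sum T a x \is a Num.int.
Proof. by move=> lx; apply: rpred_sum => u _; exact: lx. Qed.

(** Up to a positive factor, [x] pushed slightly towards [generic_vec]. *)
Definition perturb x := generic_bound *: x + generic_vec.

Lemma coord_sum_perturb x : coord_sum x = 0 -> coord_sum (perturb x) = 0.
Proof.
by move=> x0; rewrite linearD /= linearZ /= x0 coord_sum_generic_vec mulr0 addr0.
Qed.

(** The shore sum of [x] is an integer [k]. If [k] is nonzero, [generic_bound * k] outweighs the
    perturbation; if [k = 0], the sign at [generic_vec] decides, and it is negative exactly for
    semi-passive arcs. *)
Lemma shore_sum_perturb T a x : spanning_tree D T -> a \in T -> lattice x ->
  shore_sum T a (perturb x) != 0 /\
  (0 < shore_sum T a (perturb x)) = ((semi_passive D le T a)%:R <= shore_sum T a x).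
Proof.
move=> tT aT lx; have [q0 <-] := shore_sum_generic_vec tT aT.
have := generic_boundP T a; rewrite linearD /= linearZ /= ltr_norml => /andP[lo hi].
have /intrP[k ->] := int_shore_sum T a lx.
set q := shore_sum T a generic_vec in q0 lo hi *.
set M := generic_bound in lo hi *.
have M0 : 0 < M by lra.
have [k1|k1] := leP 1 k.
  have k1' : 1 <= k%:~R :> R by rewrite -[1]/(1%:~R) ler_int.
  have : M <= M * k%:~R by rewrite ler_peMr // ltW.
  move=> Mk; split; first by rewrite gt_eqF //; lra.
  by rewrite [RHS](le_trans _ k1') ?lern1 ?leq_b1 //; apply/idP; lra.
have [->|k0] := eqVneq k 0.
  rewrite mulr0 add0r; split=> //; rewrite [RHS]lern0 eqb0 -leNgt.
  by rewrite lt_def q0.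
have k1' : k%:~R <= -1 :> R by rewrite -[-1]/((-1)%:~R) ler_int; lia.
have : M * k%:~R <= - M by rewrite -mulrN1 ler_pM2l.
move=> Mk; split; first by rewrite lt_eqF //; lra.
apply/idP/idP => [|h]; first by lra.
have : (0 : R) <= (q < 0)%R%:R by rewrite ler0n.
by lra.
Qed.

Lemma perturb_half_open T x : spanning_tree D T -> lattice x -> coord_sum x = 0 ->
  (in_open_cone T (perturb x) <-> in_half_open_cone T x) /\
  (in_cone T (perturb x) -> in_open_cone T (perturb x)).
Proof.
move=> tT lx x0; have y0 := coord_sum_perturb x0.
split; first split=> -[_ h]; [| |move=> [_ h]]; split=> // a aT;
  have [n0 e0] := shore_sum_perturb tT aT lx.
- by rewrite -e0 h.
- by rewrite e0 h.
- by rewrite lt_def n0 h.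
Qed.

End GenericVector.

(** * Lattice points of the dilates *)

Section Ehrhart.
Variables (R : realType) (V : finType) (e : rel V) (TT : {set {set V * V}}).
Variable le : rel (V * V).
Hypotheses (irr : irreflexive e) (edge : exists u v, e u v).
Hypothesis dTT : dissecting_tree_set R e TT.
Let P := sym_edge_polytope R e.
Let D := bidirected e.
Hypothesis ord : total_order_on D le.
Implicit Types (T : {set V * V}) (x : 'rV[R]_#|V|).

Lemma half_open_unique T T' x : T \in TT -> T' \in TT -> lattice x ->
  in_half_open_cone D le T x -> in_half_open_cone D le T' x -> T = T'.
Proof.
move=> TTT TTT' lx hT hT'.
apply: (dissecting_unique irr edge dTT TTT TTT' (y := perturb D le x)).
  by apply/(perturb_half_open ord (dissecting_tree dTT TTT) lx _).1 => //; case: hT.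
by apply/(perturb_half_open ord (dissecting_tree dTT TTT') lx _).1 => //; case: hT.
Qed.

Lemma half_open_cover x : lattice x -> coord_sum x = 0 ->
  exists2 T, T \in TT & in_half_open_cone D le T x.
Proof.
move=> lx x0; have [T0 T0TT] := dissecting_neq0 irr edge dTT.
have tT0 := dissecting_tree dTT T0TT.
have /set0Pn[a aT] := spanning_tree_neq0 R irr edge tT0.
have [|T TTT cT] := dissecting_cover irr edge dTT (coord_sum_perturb D le x0).
  (* The cover applies to nonzero vectors only; the perturbed point is nonzero, even for [x = 0], as
     its shore sums do not vanish. *)
  have [+ _] := shore_sum_perturb ord tT0 aT lx.
  by apply: contraNneq => ->; rewrite linear0.
exists T => //; have [h1 h2] := perturb_half_open ord (dissecting_tree dTT TTT) lx x0.
exact/h1/h2.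
Qed.

Lemma lattice_dilateP (t : nat) x : lattice x ->
  dilate t P x <->
  exists2 T, T \in TT & in_half_open_cone D le T x /\ tree_height T x <= t%:R.
Proof.
move=> lx; split=> [[p Pp px]|[T TTT [hx xt]]]; last first.
  have [p Pp px] := in_cone_polytope edge dTT TTT (half_open_coneW hx) xt.
  by exists p.
have p0 : coord_sum p = 0 by apply/affine_sym_edge_sum/conv_sub_affine_hull/sub_conv_hull/Pp.
have [|T TTT hT] := half_open_cover lx; first by rewrite -px linearZ /= p0 mulr0.
exists T => //; split=> //; rewrite -px.
by apply: (tree_height_le irr edge dTT) => //; rewrite px; exact: half_open_coneW hT.
Qed.

Definition tree_point (t : nat) (Tc : {set V * V} * {ffun V * V -> 'I_t.+1}) :
  'rV[R]_#|V| := \sum_(a in Tc.1) (Tc.2 a)%:R *: arc_vec R a.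

(** Values are fixed to 0 off [T], so that a point of the cone determines its coefficients as a
    function on all arcs. *)
Definition tree_coeffs (t : nat) T :=
  [set c : {ffun V * V -> 'I_t.+1} |
    [forall a, if a \in T then (a \in [set b | semi_passive D le T b]) <= c a
               else c a == ord0]%N && (\sum_(a in T) c a <= t)%N]%SET.

Lemma lattice_tree_point (t : nat) Tc : lattice (@tree_point t Tc).
Proof.
move=> j; rewrite /tree_point summxE; apply: rpred_sum => a _.
rewrite !mxE; apply: rpredM; first exact: rpred_nat.
by apply: rpredB; exact: rpred_nat.
Qed.

Lemma shore_tree_point (t : nat) T c a : T \in TT -> a \in T ->
  shore_sum T a (@tree_point t (T, c)) = (c a)%:R.
Proof.
move=> TTT aT.
exact: (shore_sum_comb (fun a => (c a)%:R) (dissecting_tree dTT TTT) aT).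
Qed.

Lemma tree_point_half_open (t : nat) T c : T \in TT -> c \in tree_coeffs t T ->
  in_half_open_cone D le T (tree_point (T, c)) /\
  tree_height T (tree_point (T, c)) <= t%:R.
Proof.
move=> TTT; rewrite inE => /andP[/forallP cT ct]; split; last first.
  rewrite /tree_height; under eq_bigr => a aT do rewrite shore_tree_point //.
  by rewrite -natr_sum ler_nat.
split=> [|a aT].
  by rewrite linear_sum big1 // => a _; rewrite linearZ /= coord_sum_arc mulr0.
by rewrite shore_tree_point // ler_nat; have := cT a; rewrite aT inE.
Qed.

(** The coefficients are the shore sums of [x]: integers as [x] is a lattice point, nonnegative in
    the cone, and at most [t] because their sum is. *)
Lemma half_open_tree_point (t : nat) T x : T \in TT -> lattice x ->
  in_half_open_cone D le T x -> tree_height T x <= t%:R ->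
  exists2 c, c \in tree_coeffs t T & x = tree_point (T, c).
Proof.
move=> TTT lx [x0 xT] xt; have tT := dissecting_tree dTT TTT.
have x_ge0 a : a \in T -> 0 <= shore_sum T a x by move=> /xT; exact/le_trans/ler0n.
have xnat a : a \in T -> (Num.truncn (shore_sum T a x))%:R = shore_sum T a x.
  move=> aT; apply/eqP; rewrite -[_ == _]natrEtruncn natrEint int_shore_sum //.
  exact: x_ge0.
have xle a : a \in T -> (Num.truncn (shore_sum T a x) <= t)%N.
  move=> aT; rewrite -(ler_nat R) xnat //; apply: le_trans xt.
  rewrite /tree_height (bigD1 a) //= lerDl sumr_ge0 // => b /andP[bT _].
  exact: x_ge0.
pose c := [ffun a => if a \in T then inord (Num.truncn (shore_sum T a x)) else ord0]
  : {ffun V * V -> 'I_t.+1}.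
have cE a : a \in T -> (c a)%:R = shore_sum T a x.
  by move=> aT; rewrite ffunE aT inordK ?xnat // ltnS xle.
exists c; last first.
  rewrite {1}(tree_expand tT x0); apply: eq_bigr => a aT.
  by rewrite cE.
rewrite inE; apply/andP; split.
  apply/forallP => a; have [aT|aT] := boolP (a \in T); last by rewrite ffunE (negPf aT).
  by rewrite inE -(ler_nat R) cE // xT.
rewrite -(ler_nat R) natr_sum; apply: le_trans xt.
by rewrite /tree_height; apply: ler_sum => a aT; rewrite cE.
Qed.

(** [tree_point] is a bijection from the admissible pairs to the lattice points: the half-open cone
    identifies the tree, and then the shore sums identify the coefficients. *)
Lemma ehrhart_sym_edge (t : nat) : ehrhart P t =
  (\sum_(T in TT) 'C(t + #|T| - num_semi_passive D le T, #|T|))%N.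
Proof.
pose B := [set Tc : {set V * V} * {ffun V * V -> 'I_t.+1} |
  (Tc.1 \in TT) && (Tc.2 \in tree_coeffs t Tc.1)]%SET.
have imB : dilate t P `&` @lattice R #|V| = [set tree_point Tc | Tc in [set` B]].
  apply/seteqP; split=> [x [tPx lx]|_ [[T c] /= + <-]].
    have [T TTT [hT xt]] := (lattice_dilateP t lx).1 tPx.
    have [c cT ->] := half_open_tree_point TTT lx hT xt.
    by exists (T, c) => //=; rewrite inE TTT.
  rewrite inE => /andP[/= TTT cT]; have lp := @lattice_tree_point t (T, c).
  split=> //; apply/(lattice_dilateP t lp); exists T => //.
  exact: tree_point_half_open.
have memB T c : ((T, c) \in B) = (T \in TT) && (c \in tree_coeffs t T) by rewrite inE.
have injB : {in B &, injective (@tree_point t)}.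
  move=> [T c] [T' c']; rewrite !memB => /andP[TTT cT] /andP[TTT' cT'] eqp.
  have TE : T = T'.
    have [hT _] := tree_point_half_open TTT cT.
    have [hT' _] := tree_point_half_open TTT' cT'.
    apply: half_open_unique TTT TTT' (@lattice_tree_point t (T, c)) hT _.
    by rewrite eqp.
  rewrite -{T'}TE in TTT' cT' eqp *; congr (_, _); apply/ffunP => a.
  have [aT|aT] := boolP (a \in T); last first.
    move: cT cT'; rewrite !inE => /andP[/forallP/(_ a) + _] /andP[/forallP/(_ a) + _].
    by rewrite (negPf aT) => /eqP -> /eqP ->.
  apply/val_inj/eqP; rewrite -(eqr_nat R) /=.
  by rewrite -!(shore_tree_point _ TTT aT) eqp.
have -> : ehrhart P t = #|B|.
  rewrite /ehrhart imB (_ : [set _ | _ in _] = [set` [fset tree_point Tc | Tc in B]%fset]).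
    by rewrite set_fsetK card_in_imfset //= cardE.
  apply/seteqP; split=> [_ [Tc TcB <-]|x /imfsetP[Tc /= TcB ->]] /=; last by exists Tc.
  by apply/imfsetP; exists Tc.
rewrite -sum1_card (eq_bigl (fun Tc => (Tc.1 \in TT) && (Tc.2 \in tree_coeffs t Tc.1)));
  last by move=> Tc; rewrite inE.
rewrite -(pair_big_dep (fun T => T \in TT) (fun T c => c \in tree_coeffs t T)
  (fun _ _ => 1%N)) /=.
apply: eq_bigr => T TTT; rewrite sum1_card card_dominating_ffun //.
by apply/fintype.subsetP => a; rewrite inE => /andP[].
Qed.

End Ehrhart.

(** * Reading off the coefficients of the h-star polynomial *)

Lemma num_semi_passive_le (V : finType) (D T : {set V * V}) (le : rel (V * V)) :
  (num_semi_passive D le T <= #|T|)%N.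
Proof.
by apply/subset_leq_card/fintype.subsetP => a; rewrite inE => /andP[].
Qed.

Theorem theorem1p7 (R : realType) (V : finType) (e : rel V)
    (TT : {set {set V * V}}) (le : rel (V * V)) :
  simple_graph e ->
  (exists u v, e u v) ->
  dissecting_tree_set R e TT ->
  total_order_on (bidirected e) le ->
  forall i : nat,
    (hstar_poly (sym_edge_polytope R e))`_i =
    #|[set T in TT | num_semi_passive (bidirected e) le T == i]%SET|%:R.
Proof.
move=> [_ irr] edge dTT ord i; set D := bidirected e.
pose p T := num_semi_passive D le T.
have [T0 T0TT] := dissecting_neq0 irr edge dTT; have tT0 := dissecting_tree dTT T0TT.
set d := #|T0|.
have dE T : T \in TT -> #|T| = d.
  by move=> /(dissecting_tree dTT) tT; rewrite (card_spanning_tree R tT tT0).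
have pd T : T \in TT -> (p T < d.+1)%N.
  by move=> TTT; rewrite ltnS -(dE T TTT) num_semi_passive_le.
pose h : {poly R} := \poly_(k < d.+1) #|[set T in TT | p T == k]%SET|%:R.
have hE : is_hstar_poly (sym_edge_polytope R e) h.
  exists d; split=> [||t]; last 1 first.
  - rewrite (ehrhart_sym_edge irr edge dTT ord t) natr_sum.
    (* Trees are grouped by their number of semi-passive arcs; [inord] is faithful since that number
       is at most [d]. *)
    rewrite (partition_big (fun T => inord (p T) : 'I_d.+1) predT) //=.
    apply: eq_bigr => k _; rewrite coef_poly ltn_ord -sumr_const.
    rewrite mulr_suml; apply: eq_big => [T|T /andP[TTT /eqP <-]].
      rewrite inE; have [TTT|//] := boolP (T \in TT).
      by rewrite -val_eqE /= inordK ?pd.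
    by rewrite mul1r inordK ?pd // dE.
  (* The affine hull is the whole sum-zero hyperplane, a linear space of dimension [#|T0|]. *)
  - exists 0, <<tree_basis R T0>>%VS; split; first exact: dim_tree_span tT0.
    have T0n := spanning_tree_neq0 R irr edge tT0.
    apply/seteqP; split=> [x /(affine_sym_edge_polytope tT0 T0n) x0|_ [u /= uU <-]].
      by exists x; rewrite ?add0r //= (mem_tree_span _ tT0) x0.
    apply/(affine_sym_edge_polytope tT0 T0n); rewrite add0r; apply/eqP.
    by rewrite -(mem_tree_span _ tT0).
  - exact: size_poly.
have -> : hstar_poly (sym_edge_polytope R e) = h.
  by apply: xget_unique => // h' h'P; exact: is_hstar_poly_unique h'P hE.
rewrite coef_poly; case: ltnP => // di.
(* Beyond degree [d] no tree has that many semi-passive arcs, so both sides are 0. *)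
rewrite (_ : [set T in TT | _]%SET = finset.set0) ?cards0 //.
apply/setP => T; rewrite !inE; apply/negP => /andP[TTT /eqP pT].
by have := pd T TTT; rewrite /p pT ltnNge di.
Qed.
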